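(* Let $n\in\{0,1,2,\dots\}$. Then $$ME_{n,\delta}\to 1\quad\text{as }\delta\downarrow 0,\qquad ME_{n,\delta}\to\frac{1}{(n+1)!}\quad\text{as }\delta\uparrow n+1.$$
   Context: For $n\in\{0,1,2,\dots\}$ and $\delta\in(0,n+1)$, $$E_{n,\delta}(s)=\frac{1-\Bigl(1+\frac{s^1}{1!}+\dots+\frac{s^n}{n!}\Bigr)e^{-s}}{s^{\delta}}\quad(s>0),\qquad E_{n,\delta}(0)=0,$$ and $ME_{n,\delta}=\max_{s\ge 0}E_{n,\delta}(s)$ (the maximum is attained). *)

(* Defs.v *)
From HB Require Import structures.
From mathcomp Require Import all_boot all_order all_algebra.
From mathcomp Require Import all_classical all_reals all_analysis.

Set Implicit Arguments.
Unset Strict Implicit.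
Unset Printing Implicit Defensive.

Import Order.TTheory GRing.Theory Num.Theory.
Import numFieldNormedType.Exports.

Local Open Scope classical_set_scope.
Local Open Scope ring_scope.

(* Only the values at s >= 0 are meaningful: powR is not the real power at a
   negative base. *)
Definition E {R : realType} (n : nat) (delta s : R) : R :=
  if s == 0 then 0
  else (1 - (\sum_(0 <= k < n.+1) s ^+ k / k`!%:R) * expR (- s)) / s `^ delta.

(* The greatest element of the set of values of E n delta on [0, +oo[.  A
   greatest element is unique when it exists; the default value 0 would be
   used only if the maximum were not attained. *)
Definition ME {R : realType} (n : nat) (delta : R) : R :=
  let values := E n delta @` `[0, +oo[ in
  xget 0 (values `&` ubound values).

(* Main.v *)
Require Import Defs.
From HB Require Import structures.
From mathcomp Require Import all_boot all_order all_algebra.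
From mathcomp Require Import all_classical all_reals all_analysis.
From mathcomp Require Import ring lra.

Set Implicit Arguments.
Unset Strict Implicit.
Unset Printing Implicit Defensive.

Import Order.TTheory GRing.Theory Num.Theory.
Import numFieldNormedType.Exports.

Local Open Scope classical_set_scope.
Local Open Scope ring_scope.

(** Write N = n + 1 and T s for the numerator of E n delta s, that is, the
probability that a Poisson variable of mean s is at least N.  It satisfies
T s <= 1 ([poisson_tail_le1]) and T s <= s^N / N! ([poisson_tail_le_coeff]),
so E n delta s is at most the smaller of s^-delta and s^(N - delta) / N!.  For
0 <= delta <= N the first of these decreases in s and the second increases;
they are equal where s^N = N!, whence the bound, uniform in s,
<<
   E n delta s <= (N!)^(- delta / N)
>>
([Eexp_le]).  It tends to 1 as delta goes to 0 and to 1 / N! as delta goes to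
N, which are the two required limits.

Conversely, for every fixed s the maximum is at least E n delta s, which is
continuous in delta up to the endpoints.  At delta = 0 it is T s, close to 1
when s is large ([poisson_tail_expR_approx1]); at delta = N it is T s / s^N,
close to 1 / N! when s is small ([Eexp_approx_fact]).  So in both cases the
upper bound is approached by values of E; [ME_cvg] is this squeeze.

The maximum must be attained for ME to mean anything ([ME_Eexp]): the two
bounds on T make E small near 0 and at infinity, and the extreme value
theorem applies in between.

The variable is changed to s = exp t throughout.  Real powers of s then become
exponentials of linear functions of t, and the half-line s > 0 becomes the
whole line, on which E is continuous without restriction. *)

Section MaxE.
Context {R : realType}.
Implicit Types (s t delta : R) (m n : nat).

(** * Partial sums of the exponential series *)

Lemma series_exp_coeff_le_expR m s : 0 <= s -> series (exp_coeff s) m <= expR s.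
Proof.
move=> s0; apply: nondecreasing_cvgn_le; last exact: is_cvg_series_exp_coeff.
by apply: nondecreasing_series => k _ _; exact: exp_coeff_ge0.
Qed.

(** This is m! j! <= (m + j)!, from the integrality of binomial coefficients.
It compares the remainder of the exponential series after m terms with s^m/m!
times the whole series, without a Taylor formula. *)
Lemma exp_coeffD_le m j s : 0 <= s ->
  exp_coeff s (m + j)%N <= exp_coeff s m * exp_coeff s j.
Proof.
move=> s0; rewrite /exp_coeff /= mulrACA -exprD -invfM -natrM.
rewrite ler_wpM2l ?exprn_ge0// lef_pV2 ?posrE ?ltr0n ?muln_gt0 ?fact_gt0//.
rewrite ler_nat -(bin_fact (leq_addr j m)) addKn.
by rewrite leq_pmull// bin_gt0 leq_addr.
Qed.

Lemma expR_le_seriesD m s : 0 <= s ->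
  expR s <= series (exp_coeff s) m + exp_coeff s m * expR s.
Proof.
move=> s0; apply: limr_le; first exact: is_cvg_series_exp_coeff.
near=> k; have mk : (m <= k)%N by near: k; exact: nbhs_infty_ge.
rewrite -(subnKC mk) /series /= (big_cat_nat (leq0n m) (leq_addr _ _))/=.
rewrite lerD2l -{1}[m]add0n big_addn addKn.
apply: (@le_trans _ _ (exp_coeff s m * series (exp_coeff s) (k - m)%N)).
  rewrite /series /= mulr_sumr; apply: ler_sum => i _.
  by rewrite [(i + m)%N]addnC; exact: exp_coeffD_le.
by rewrite ler_wpM2l ?exp_coeff_ge0// series_exp_coeff_le_expR.
Unshelve. all: end_near. Qed.

(** * Poisson tail probabilities *)

Definition poisson_tail m s : R := 1 - series (exp_coeff s) m * expR (- s).

Lemma poisson_tail_le1 m s : 0 <= s -> poisson_tail m s <= 1.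
Proof.
move=> s0; rewrite /poisson_tail gerBl mulr_ge0 ?expR_ge0//.
by apply: sumr_ge0 => k _; exact: exp_coeff_ge0.
Qed.

Lemma poisson_tail_le_coeff m s : 0 <= s -> poisson_tail m s <= exp_coeff s m.
Proof.
move=> s0; rewrite -(ler_pM2r (expR_gt0 s)) /poisson_tail mulrBl mul1r -mulrA.
by rewrite -expRD addNr expR0 mulr1 lerBlDl expR_le_seriesD.
Qed.

(** The probability of being at least m is at least that of being exactly m. *)
Lemma poisson_tail_ge_coeff m s : 0 <= s ->
  exp_coeff s m * expR (- s) <= poisson_tail m s.
Proof.
move=> s0; rewrite /poisson_tail lerBrDl -mulrDl expRN.
rewrite ler_pdivrMr ?expR_gt0// mul1r.
by have := series_exp_coeff_le_expR m.+1 s0; rewrite /series /= big_nat_recr.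
Qed.

(** For a Poisson variable X of mean s, this is Markov's inequality for
1 / (X + 1), which has mean at most 1 / s.  In terms of series: from
s * s^k/k! = (k + 1) * s^(k+1)/(k+1)!, the first m terms of the exponential
series multiplied by s are at most m times the whole series. *)
Lemma poisson_tail_ge m s : 0 < s -> 1 - m%:R / s <= poisson_tail m s.
Proof.
move=> s0; rewrite /poisson_tail lerD2l lerN2 expRN ler_pdivrMr ?expR_gt0//.
rewrite mulrAC ler_pdivlMr//.
apply: (@le_trans _ _ (m%:R * series (exp_coeff s) m.+1)); last first.
  by rewrite ler_wpM2l// series_exp_coeff_le_expR// ltW.
have c0 k : 0 <= exp_coeff s k by rewrite exp_coeff_ge0 ?ltW.
rewrite /series /= big_nat_recl// mulrDr mulr_suml.
apply: ler_wpDl; first by rewrite mulr_ge0.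
rewrite mulr_sumr !big_mkord; apply: ler_sum => k _.
have -> : exp_coeff s k * s = k.+1%:R * exp_coeff s k.+1.
  rewrite /exp_coeff /= factS natrM exprSr invfM [RHS]mulrC -!mulrA.
  congr (_ * _).
  by rewrite [_^-1 * k.+1%:R]mulrC mulKf ?pnatr_eq0// mulrC.
by rewrite ler_wpM2r// ler_nat.
Qed.

Lemma continuous_poisson_tail m : continuous (poisson_tail m).
Proof.
have cs : continuous (fun s : R => series (exp_coeff s) m).
  elim: m => [|m IH] s.
    rewrite (_ : (fun _ => _) = cst 0); first exact: cst_continuous.
    by apply/funext => x; rewrite /series /= big_nil.
  rewrite (_ : (fun _ => _) =
      (fun x => series (exp_coeff x) m + x ^+ m / m`!%:R)); last first.
    by apply/funext => x; rewrite /series /= big_nat_recr.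
  apply: cvgD; first exact: IH.
  by apply: cvgMr_tmp; exact: exprn_continuous.
move=> s; apply: cvgB; first exact: cvg_cst.
apply: cvgM; first exact: cs.
apply: (@continuous_comp _ _ _ -%R expR); first exact: opp_continuous.
exact: continuous_expR.
Qed.

(** * The function E in the variable t = ln s *)

Definition Eexp m delta t : R := poisson_tail m (expR t) * expR (- (delta * t)).

Lemma E_expR n delta t : E n delta (expR t) = Eexp n.+1 delta t.
Proof.
rewrite /E gt_eqF ?expR_gt0// -expRM /Eexp.
by rewrite [expR (- (delta * t))]expRN [delta * t]mulrC.
Qed.

Lemma continuous_Eexp m delta : continuous (Eexp m delta).
Proof.
move=> t; apply: cvgM.
  apply: (@continuous_comp _ _ _ expR (poisson_tail m)).
    exact: continuous_expR.
  exact: continuous_poisson_tail.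
apply: (@continuous_comp _ _ _ (fun t => - (delta * t)) expR).
  by apply: cvgN; apply: cvgMl_tmp; exact: cvg_id.
exact: continuous_expR.
Qed.

Lemma continuous_Eexp_exponent m t : continuous (Eexp m ^~ t).
Proof.
move=> delta; apply: cvgM; first exact: cvg_cst.
apply: (@continuous_comp _ _ _ (fun d : R => - (d * t)) expR).
  by apply: cvgN; apply: cvgMr_tmp; exact: cvg_id.
exact: continuous_expR.
Qed.

(** The t at which the two upper bounds 1 and exp (t m) / m! on the tail
coincide. *)
Definition crossing m : R := ln m`!%:R / m%:R.

Lemma expR_crossing m : (0 < m)%N -> expR (m%:R * crossing m) = m`!%:R.
Proof.
move=> m0; rewrite /crossing mulrC divfK ?pnatr_eq0 ?gtn_eqF//.
by rewrite lnK// posrE ltr0n fact_gt0.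
Qed.

Lemma poisson_tail_expR_le m t : (0 < m)%N ->
  poisson_tail m (expR t) <= expR (m%:R * (t - crossing m)).
Proof.
move=> m0; apply: le_trans (poisson_tail_le_coeff _ (expR_ge0 _)) _.
by rewrite mulrBr expRB expR_crossing// expRM_natl.
Qed.

(** To the left of [crossing] the bound exp (m (t - crossing)) on the tail is
used, to the right the bound 1; in both cases the resulting bound on Eexp is
monotone in t and is greatest at [crossing]. *)
Lemma Eexp_le m delta t : (0 < m)%N -> 0 <= delta <= m%:R ->
  Eexp m delta t <= expR (- (delta * crossing m)).
Proof.
move=> m0 /andP[d0 dm]; have e0 := expR_ge0 (- (delta * t)).
have [tc|ct] := leP t (crossing m).
  apply: le_trans (ler_wpM2r e0 (poisson_tail_expR_le t m0)) _.
  rewrite -expRD ler_expR.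
  have : (m%:R - delta) * (t - crossing m) <= 0.
    by rewrite mulr_ge0_le0 ?subr_ge0 ?subr_le0.
  lra.
apply: le_trans (ler_wpM2r e0 (poisson_tail_le1 m (expR_ge0 t))) _.
by rewrite mul1r ler_expR lerN2 ler_wpM2l// ltW.
Qed.

Lemma Eexp_gt0 m delta t : 0 < Eexp m delta t.
Proof.
rewrite mulr_gt0 ?expR_gt0//.
apply: lt_le_trans (poisson_tail_ge_coeff m (expR_ge0 t)).
by rewrite /exp_coeff /= mulr_gt0 ?expR_gt0// divr_gt0 ?exprn_gt0 ?expR_gt0
  ?ltr0n ?fact_gt0.
Qed.

(** The value c at t = 0 is positive, and Eexp is at most c outside a bounded
interval: it is bounded by a multiple of exp ((m - delta) t), which vanishes to
the left since delta < m, and by exp (- delta t), which vanishes to the right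
since 0 < delta. *)
Lemma Eexp_argmax m delta : (0 < m)%N -> 0 < delta < m%:R ->
  exists t0, forall t, Eexp m delta t <= Eexp m delta t0.
Proof.
move=> m0 /andP[d0 dm].
set c := Eexp m delta 0.
have c0 : 0 < c := Eexp_gt0 _ _ _.
have md0 : 0 < m%:R - delta by rewrite subr_gt0.
(* The points where the left and the right upper bounds are equal to c. *)
pose a := (ln c + m%:R * crossing m) / (m%:R - delta).
pose b := - ln c / delta.
have left_a t : t <= a -> Eexp m delta t <= c.
  move=> ta.
  apply: le_trans (ler_wpM2r (expR_ge0 _) (poisson_tail_expR_le t m0)) _.
  rewrite -expRD -[leRHS]lnK ?posrE// ler_expR.
  by move: ta; rewrite ler_pdivlMr//; lra.
have right_b t : b <= t -> Eexp m delta t <= c.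
  move=> bt.
  apply: le_trans (ler_wpM2r (expR_ge0 _) (poisson_tail_le1 m (expR_ge0 t))) _.
  rewrite mul1r -[leRHS]lnK ?posrE// ler_expR.
  by move: bt; rewrite ler_pdivrMr//; lra.
(* The interval has to contain 0, where the value c is taken. *)
pose A := Num.min a 0; pose B := Num.max b 0.
have A0 : A <= 0 by rewrite ge_min lexx orbT.
have B0 : 0 <= B by rewrite le_max lexx orbT.
have [||t0 _ ht0] := @EVT_max R (Eexp m delta) A B.
- exact: le_trans B0.
- by apply: continuous_subspaceT; exact: continuous_Eexp.
have ct0 : c <= Eexp m delta t0 by apply: ht0; rewrite in_itv/= A0 B0.
exists t0 => t.
have [tA|At] := leP t A.
  by apply: le_trans ct0; apply: left_a; move: tA; rewrite le_min => /andP[].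
have [tB|Bt] := leP t B; first by apply: ht0; rewrite in_itv/= tB ltW.
apply: le_trans ct0; apply: right_b.
by move: Bt; rewrite gt_max => /andP[/ltW].
Qed.

(** * The maximum and its limits *)

(** The value 0 of E at s = 0 lies outside the range of t, but cannot be the
maximum since Eexp is positive. *)
Lemma ME_Eexp n delta : 0 < delta < n.+1%:R ->
  exists2 t0, ME n delta = Eexp n.+1 delta t0 &
    forall t, Eexp n.+1 delta t <= Eexp n.+1 delta t0.
Proof.
move=> dn; have [t0 ht0] := Eexp_argmax (ltn0Sn n) dn.
exists t0 => //; rewrite /ME.
have mem_t0 : (E n delta @` `[0, +oo[) (Eexp n.+1 delta t0).
  by exists (expR t0); rewrite ?E_expR//= in_itv/= andbT expR_ge0.
apply: xget_unique.
  split=> //.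
  move=> y [s /=]; rewrite in_itv/= andbT le_eqVlt => /predU1P[<-|s0] <-{y}.
    by rewrite /E eqxx ltW ?Eexp_gt0.
  by rewrite -(lnK s0) E_expR.
move=> y [[s /=]]; rewrite in_itv/= andbT le_eqVlt => /predU1P[<-|s0] <-{y} ub.
  have : Eexp n.+1 delta t0 <= E n delta 0 by apply: ub.
  by rewrite /E eqxx leNgt Eexp_gt0.
move: ub; rewrite -(lnK s0) E_expR => ub.
by apply/le_anti; rewrite ht0/=; exact: ub.
Qed.

(** The upper bound [Eexp_le] converges to the claimed limit by continuity.  If
some single t brings Eexp at delta0 above the limit minus e, then continuity
in the exponent does the same for every delta near delta0, and hence for the
maximum. *)
Lemma ME_cvg n delta0 (F : set_system R) : Filter F -> F --> delta0 ->
  (\forall delta \near F, 0 < delta < n.+1%:R) ->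
  (forall e, 0 < e -> exists t,
    expR (- (delta0 * crossing n.+1)) - e < Eexp n.+1 delta0 t) ->
  ME n delta @[delta --> F] --> expR (- (delta0 * crossing n.+1)).
Proof.
move=> FF Fd0 Fn approx; apply/cvgrPdist_lt => e e0.
have [t ht] := approx _ e0.
have up : expR (- (delta * crossing n.+1)) @[delta --> F] -->
    expR (- (delta0 * crossing n.+1)).
  apply: (@continuous_cvg _ _ _ _ _ _ expR); first exact: continuous_expR.
  by apply: cvgN; exact: (cvgMr_tmp Fd0).
have low : Eexp n.+1 delta t @[delta --> F] --> Eexp n.+1 delta0 t.
  apply: (@continuous_cvg _ _ _ _ _ _ (Eexp n.+1 ^~ t)) Fd0.
  exact: continuous_Eexp_exponent.
near=> delta.
have dn : 0 < delta < n.+1%:R by near: delta.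
have [t0 -> /(_ t) tt0] := ME_Eexp dn.
rewrite ltr_distlC; apply/andP; split.
  apply: lt_le_trans tt0; near: delta; exact: (cvgr_gt _ low).
apply: le_lt_trans (Eexp_le t0 (ltn0Sn n) _) _.
  by case/andP: dn => /ltW-> /ltW->.
near: delta; apply: (cvgr_lt _ up); lra.
Unshelve. all: end_near. Qed.

Lemma poisson_tail_expR_approx1 m (e : R) : 0 < e ->
  exists t, 1 - e < poisson_tail m (expR t).
Proof.
move=> e0; exists (ln (m.+1%:R / e)).
have s0 : 0 < m.+1%:R / e by rewrite divr_gt0.
rewrite lnK//; apply: lt_le_trans (poisson_tail_ge m s0).
rewrite ltrD2l ltrN2 invf_div mulrA ltr_pdivrMr// mulrC ltr_pM2l//.
by rewrite ltr_nat.
Qed.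

(** With s = exp t, the value at delta = m is at least exp (- s) / m!, which
tends to 1 / m! as s goes to 0. *)
Lemma Eexp_approx_fact m (e : R) : 0 < e ->
  exists t, m`!%:R^-1 - e < Eexp m m%:R t.
Proof.
move=> e0; exists (ln (e / 2)).
have s0 : 0 < e / 2 by rewrite divr_gt0.
(* The loss is at most (e / 2) / m!, and m! >= 1. *)
have f1 : m`!%:R^-1 <= 1 :> R by rewrite invf_le1 ?ler1n ?ltr0n ?fact_gt0.
have f0 : 0 <= m`!%:R^-1 :> R by rewrite invr_ge0.
apply: (@lt_le_trans _ _ (m`!%:R^-1 * expR (- (e / 2)))).
  apply: (@lt_le_trans _ _ (m`!%:R^-1 * (1 - e / 2))); first nra.
  by rewrite ler_wpM2l// expR_ge1Dx.
rewrite /Eexp lnK// [expR (- (m%:R * _))]expRN expRM_natl lnK//.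
rewrite ler_pdivlMr ?exprn_gt0//.
apply: le_trans (poisson_tail_ge_coeff m (ltW s0)).
by rewrite /exp_coeff /= le_eqVlt; apply/orP; left; apply/eqP; ring.
Qed.

End MaxE.

Theorem proposition9 (R : realType) (n : nat) :
  (ME n delta @[delta --> (0 : R)^'+] --> (1 : R)) /\
  (ME n delta @[delta --> (n.+1%:R : R)^'-] --> ((n.+1)`!%:R^-1 : R)).
Proof.
split.
- have <- : expR (- (0 * crossing n.+1)) = 1 :> R by rewrite mul0r oppr0 expR0.
  apply: ME_cvg; first exact: cvg_at_right_filter.
    near=> d; apply/andP; split; first by near: d; exact: nbhs_right_gt.
    by near: d; exact: nbhs_right_lt.
  move=> e /(poisson_tail_expR_approx1 n.+1)[t ht]; exists t.
  by rewrite /Eexp !mul0r oppr0 expR0 mulr1.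
- have <- : expR (- (n.+1%:R * crossing n.+1)) = (n.+1)`!%:R^-1 :> R.
    by rewrite expRN expR_crossing.
  apply: ME_cvg; first exact: cvg_at_left_filter.
    near=> d; apply/andP; split; last by near: d; exact: nbhs_left_lt.
    by near: d; exact: nbhs_left_gt.
  by move=> e e0; rewrite expRN expR_crossing//; exact: Eexp_approx_fact.
Unshelve. all: end_near. Qed.
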